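(* Let $K/k$ be a finite Galois extension of fields with group $G=\mathrm{Gal}(K/k)$. Let $N\le \operatorname{Perm}(G)$ be a regular subgroup normalized by $\lambda(G)$, and let $P\triangleleft N$ be a normal subgroup of $N$ that is also normalized by $\lambda(G)$. Let $H_P=(K[P])^{\lambda(G)}$, $F=K^{H_P}$ and $J=\mathrm{Gal}(K/F)\le G$, and assume $J\triangleleft G$. Then the extension $F/k$ is Hopf-Galois with respect to the $k$-Hopf algebra $$H_{N/P}=(F[N/P])^{\lambda(G)/\lambda(J)}.$$
   Context: $\operatorname{Perm}(X)$ is the group of permutations of a set $X$; a subgroup of $\operatorname{Perm}(X)$ is regular if it acts transitively on $X$ with trivial point stabilizers. $\lambda:G\to\operatorname{Perm}(G)$ is the left regular representation, $\lambda(a)(b)=ab$; $i_G$ is the identity of $G$. For a subgroup $M\le \operatorname{Perm}(G)$ normalized by $\lambda(G)$, $\lambda(G)$ acts on the group ring $K[M]$ by $\gamma\cdot\sum_{n} c_n n=\sum_n \gamma(c_n)\,\lambda(\gamma)n\lambda(\gamma)^{-1}$ ($\gamma\in G$), and $(K[M])^{\lambda(G)}$ denotes the fixed ring, a $k$-Hopf algebra. For $N$ regular, $H_N=(K[N])^{\lambda(G)}$ acts on $K$ by $h(x)=\sum_{n\in N}c_n\,\bigl(n^{-1}(i_G)\bigr)(x)$ for $h=\sum_{n\in N} c_n n\in H_N$, $x\in K$ (here $n^{-1}(i_G)\in G$ is applied to $x$ as an automorphism of $K$). $H_P\subseteq H_N$ is a Hopf subalgebra, and $K^{H_P}=\{x\in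 K: h(x)=\varepsilon(h)x\ \forall h\in H_P\}$, where $\varepsilon(\sum c_n n)=\sum c_n$; this is an intermediate field of $K/k$. $N$ and $\lambda(G)$ act on the set $G/J$ of left cosets of $J$ in $G$ by $n\cdot gJ=n(gJ)=n(g)J$ and $\lambda(\gamma)\cdot gJ=\gamma gJ$. These induce embeddings of $N/P$ and $\lambda(G)/\lambda(J)$ in $\operatorname{Perm}(G/J)$, with $\lambda(G)/\lambda(J)$ normalizing $N/P$. The action of $\lambda(G)/\lambda(J)$ on $F[N/P]$ is by $\mathrm{Gal}(F/k)=G/J$ on the coefficients and by conjugation in $\operatorname{Perm}(G/J)$ on $N/P$, simultaneously: the class of $\lambda(\gamma)$ sends $\sum_{\eta}c_\eta\,\eta P$ to $\sum_\eta \gamma(c_\eta)\,\lambda(\gamma)\eta\lambda(\gamma)^{-1}P$. A finite separable extension $L/k$ is Hopf-Galois with respect to a $k$-Hopf algebra $H$ (comultiplication $\Delta$, counit $\varepsilon$) if there is a $k$-algebra homomorphism $\mu:H\to\operatorname{End}_k(L)$ such that $\mu(h)(xy)=\sum_{(h)}\mu(h_{(1)})(x)\mu(h_{(2)})(y)$ and $\mu(h)(1)=\varepsilon(h)1$ for all $h\in H$ and $x,y\in L$, the fixed ring $\{x\in L:\mu(h)(x)=\varepsilon(h)x\ \forall h\in H\}$ equals $k$, and the map $1\#\mu: L\# H\to\operatorname{End}_k(L)$ from the smash product, $x\#h\mapsto (y\mapsto x\,\mu(h)(y))$, is an isomorphism of $k$-algebras. *)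

(* Defs.v *)
From HB Require Import structures.
From mathcomp Require Import all_boot all_order all_algebra all_fingroup.
From mathcomp Require Import all_solvable all_field.

Set Implicit Arguments.
Unset Strict Implicit.
Unset Printing Implicit Defensive.

Import GRing.Theory.
Local Open Scope ring_scope.

(* U (x) V is modelled by the matrices of coordinates on the products of the
   chosen bases of U and V; its universal property is [tens_liftE] and
   [tens_lift_uniq]. *)

Section Tensor.
Variable k : fieldType.

Definition tens (U V : vectType k) : vectType k := 'M[k]_(\dim {:U}, \dim {:V}).

Variables U V : vectType k.

Definition ptens (u : U) (v : V) : tens U V :=
  \matrix_(i, j) (coord (vbasis {:U}) i u * coord (vbasis {:V}) j v).

(* The linear map sending u (x) v to beta u v, for beta bilinear: in Sweedler's
   notation, [tens_lift beta t] is the sum of the beta(t_(1), t_(2)). *)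
Definition tens_lift (W : lmodType k) (beta : U -> V -> W) (t : tens U V) : W :=
  \sum_i \sum_j t i j *: beta (vbasis {:U})`_i (vbasis {:V})`_j.

Fact tens_lift_is_linear (W : lmodType k) (beta : U -> V -> W) : linear (tens_lift beta).
Proof.
move=> a s t; rewrite /tens_lift scaler_sumr -big_split; apply: eq_bigr => i _.
rewrite scaler_sumr -big_split; apply: eq_bigr => j _ /=.
by rewrite !mxE scalerDl scalerA.
Qed.
HB.instance Definition _ (W : lmodType k) (beta : U -> V -> W) :=
  GRing.isLinear.Build k (tens U V) W *:%R (tens_lift beta)
    (tens_lift_is_linear beta).

End Tensor.

Arguments tens {k} U V.
Arguments ptens {k U V} u v.

Lemma tens_liftE (k : fieldType) (U V : vectType k) (W : lmodType k)
    (beta : U -> V -> W) :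
    (forall u, linear (beta u)) -> (forall v, linear (beta^~ v)) ->
  forall u v, tens_lift beta (ptens u v) = beta u v.
Proof.
move=> linr linl u v.
pose r u := GRing.isLinear.Build k V W *:%R (beta u) (linr u).
pose fr u : {linear V -> W} := HB.pack (beta u) (r u).
pose l v := GRing.isLinear.Build k U W *:%R (beta^~ v) (linl v).
pose fl v : {linear U -> W} := HB.pack (beta^~ v) (l v).
rewrite [u in RHS](coord_vbasis (memvf u)) -[RHS]/(fl v _) linear_sum.
apply: eq_bigr => i _; rewrite linearZ /=.
rewrite [v in RHS](coord_vbasis (memvf v)) -[beta _ _ in RHS]/(fr _ _).
rewrite linear_sum scaler_sumr; apply: eq_bigr => j _.
by rewrite linearZ scalerA mxE.
Qed.

Lemma tens_lift_uniq (k : fieldType) (U V : vectType k) (W : lmodType k)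
    (f g : {linear tens U V -> W}) :
  (forall u v, f (ptens u v) = g (ptens u v)) -> f =1 g.
Proof.
move=> efg t; rewrite (matrix_sum_delta t) !linear_sum.
apply: eq_bigr => i _; rewrite !linear_sum; apply: eq_bigr => j _.
rewrite !linearZ; congr (_ *: _).
have <- : ptens (vbasis {:U})`_i (vbasis {:V})`_j = delta_mx i j.
  apply/matrixP=> i' j'; rewrite !mxE.
  by rewrite !coord_free ?(basis_free (vbasisP _)) // -natrM mulnb
    (eq_sym i) (eq_sym j).
exact: efg.
Qed.

Section Hopf.
Variable k : fieldType.

Definition tens_mul (A B : falgType k) (s t : tens A B) : tens A B :=
  tens_lift (fun a b =>
    tens_lift (fun c d => ptens (a * c) (b * d)) t) s.

Record hopf_structure (H : falgType k) := HopfStructure {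
  comul : {linear H -> tens H H};
  counit : {linear H -> k^o};
  antipode : {linear H -> H};
  comul1 : comul 1 = ptens 1 1;
  comulM : forall g h, comul (g * h) = tens_mul (comul g) (comul h);
  counit1 : counit 1 = 1;
  counitM : forall g h, counit (g * h) = counit g * counit h;
  comulA : forall h,
    tens_lift (fun a b => ptens a (comul b)) (comul h)
    = tens_lift (fun a b =>
        tens_lift (fun c d => ptens c (ptens d b)) (comul a)) (comul h)
      :> tens H (tens H H);
  counitl : forall h, tens_lift (fun a b => counit a *: b) (comul h) = h;
  counitr : forall h, tens_lift (fun a b => counit b *: a) (comul h) = h;
  antipodel : forall h,
    tens_lift (fun a b => antipode a * b) (comul h) = counit h *: 1;
  antipoder : forall h,
    tens_lift (fun a b => a * antipode b) (comul h) = counit h *: 1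
}.

(* Only finite-dimensional H are considered: the bijectivity of [smash_map]
   forces \dim H = \dim L anyway. *)
Section HopfGalois.
Variables (H : falgType k) (S : hopf_structure H) (L : fieldExtType k).
Variable mu : {linear H -> 'End(L)}.

(* Product of the smash product L # H, carried by L (x) H:
   (x # h)(y # g) is the sum of the x mu(h_(1))(y) # h_(2) g. *)
Definition smash_mul (s t : tens L H) : tens L H :=
  tens_lift (fun x h => tens_lift (fun y g =>
    tens_lift (fun h1 h2 => ptens (x * mu h1 y) (h2 * g)) (comul S h)) t) s.

(* [amull x] is the multiplication y |-> x * y. *)
Definition smash_map (s : tens L H) : 'End(L) :=
  tens_lift (fun x h => (amull x \o mu h)%VF) s.

Record hopf_galois_action : Prop := HopfGaloisAction {
  hg_act1 : mu 1 = \1%VF;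
  hg_actM : forall g h, mu (g * h) = (mu g \o mu h)%VF;
  hg_measure : forall h x y,
    mu h (x * y) = tens_lift (fun h1 h2 => mu h1 x * mu h2 y) (comul S h);
  hg_measure1 : forall h, mu h 1 = counit S h *: 1;
  hg_fixed : forall x : L,
    (forall h, mu h x = counit S h *: x) <-> x \in 1%VS;
  hg_smash_linear : linear smash_map;
  hg_smash1 : smash_map (ptens 1 1) = \1%VF;
  hg_smashM : forall s t,
    smash_map (smash_mul s t) = (smash_map s \o smash_map t)%VF;
  hg_smash_bij : bijective smash_map
}.

End HopfGalois.

Definition hopf_galois (L : fieldExtType k) (H : falgType k)
    (S : hopf_structure H) : Prop :=
  separable 1 {:L} /\
  exists mu : {linear H -> 'End(L)}, hopf_galois_action S mu.

End Hopf.

Arguments hopf_galois {k} L {H} S.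

(* [grpAlg K aT] is K[aT] as a k-algebra, the function u standing for the sum
   of the u(x) x. The groups of interest are made of permutations, or classes
   of permutations, for which MathComp's x * y is "first x, then y"; the
   product below is for the group law of composition, y o z = z * y. *)

Section GroupAlgebra.
Variables (k : fieldType) (K : fieldExtType k) (aT : finGroupType).

Definition grpAlg : Type := {ffun aT -> K}.
HB.instance Definition _ := Vector.copy grpAlg {ffun aT -> K}.

Implicit Types u v w : grpAlg.

Definition grpAlg_one : grpAlg := [ffun x => (x == 1%g)%:R].
Definition grpAlg_mul u v : grpAlg :=
  [ffun x => \sum_y u y * v (x * y^-1)%g].

Fact grpAlg_mulA : associative grpAlg_mul.
Proof.
move=> u v w; apply/ffunP=> x; rewrite !ffunE.
under eq_bigr => y _ do rewrite ffunE big_distrr /=.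
under [RHS]eq_bigr => y _ do rewrite ffunE big_distrl /=.
rewrite [RHS]exchange_big /=; apply: eq_bigr => y _.
rewrite (reindex_inj (mulIg y^-1%g)) /=; apply: eq_bigr => z _.
by rewrite mulrA invMg invgK !mulgA mulgKV.
Qed.

Fact grpAlg_mul1 : left_id grpAlg_one grpAlg_mul.
Proof.
move=> u; apply/ffunP=> x; rewrite !ffunE (bigD1 1%g) //= big1 => [|y].
  by rewrite ffunE eqxx mul1r invg1 mulg1 addr0.
by rewrite ffunE => /negPf->; rewrite mul0r.
Qed.

Fact grpAlg_mulr1 : right_id grpAlg_one grpAlg_mul.
Proof.
move=> u; apply/ffunP=> x; rewrite !ffunE (bigD1 x) //= big1 => [|y].
  by rewrite ffunE mulgV eqxx mulr1 addr0.
by rewrite ffunE -eq_mulgV1 eq_sym => /negPf->; rewrite mulr0.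
Qed.

Fact grpAlg_mulDl : left_distributive grpAlg_mul +%R.
Proof.
move=> u v w; apply/ffunP=> x; rewrite !ffunE -big_split.
by apply: eq_bigr => y _; rewrite ffunE mulrDl.
Qed.

Fact grpAlg_mulDr : right_distributive grpAlg_mul +%R.
Proof.
move=> u v w; apply/ffunP=> x; rewrite !ffunE -big_split.
by apply: eq_bigr => y _; rewrite ffunE mulrDr.
Qed.

Fact grpAlg_one_neq0 : grpAlg_one != 0.
Proof.
by apply/eqP => /ffunP/(_ 1%g); rewrite !ffunE eqxx => /eqP; rewrite oner_eq0.
Qed.

HB.instance Definition _ := GRing.Zmodule_isNzRing.Build grpAlg
  grpAlg_mulA grpAlg_mul1 grpAlg_mulr1 grpAlg_mulDl grpAlg_mulDr
  grpAlg_one_neq0.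

Fact grpAlg_scaleAl (a : k) u v : a *: (u * v) = (a *: u) * v.
Proof.
apply/ffunP=> x; rewrite !ffunE scaler_sumr.
by apply: eq_bigr => y _; rewrite ffunE scalerAl.
Qed.
HB.instance Definition _ :=
  GRing.Lmodule_isLalgebra.Build k grpAlg grpAlg_scaleAl.

Fact grpAlg_scaleAr (a : k) u v : a *: (u * v) = u * (a *: v).
Proof.
apply/ffunP=> x; rewrite !ffunE scaler_sumr.
by apply: eq_bigr => y _; rewrite ffunE scalerAr.
Qed.
HB.instance Definition _ :=
  GRing.Lalgebra_isAlgebra.Build k grpAlg grpAlg_scaleAr.
HB.instance Definition _ := Algebra_isFalgebra.Build k grpAlg.

Definition aug (u : grpAlg) : K := \sum_x u x.

End GroupAlgebra.

(* The Hopf structure of a k-subalgebra H of K[aT] is inherited from K[aT]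
   when, in K[aT], the comultiplication is x |-> x (x) x, the counit is
   x |-> 1 and the antipode is x |-> x^-1, for x in aT; the first clause
   compares the coefficients of x (x) y. *)
Definition inherited_hopf (k : fieldType) (K : fieldExtType k)
    (aT : finGroupType) (H : {aspace grpAlg K aT})
    (S : hopf_structure (subvs_of H)) : Prop :=
  [/\ forall (h : subvs_of H) (x y : aT),
        tens_lift (fun a b : subvs_of H => vsval a x * vsval b y) (comul S h)
        = if x == y then vsval h x else 0,
      forall h : subvs_of H, counit S h *: 1 = aug (vsval h)
    & forall (h : subvs_of H) (x : aT),
        vsval (antipode S h) x = vsval h x^-1%g].

Section FixedRing.
Variables (k : fieldType) (K : splittingFieldType k) (aT : finGroupType).
Local Notation G := (gal_of {:K}).
Variable f : G -> aT.

(* g maps the sum of the c_x x to that of the g(c_x) f(g) o x o f(g)^-1, the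
   composite being x ^ f g for MathComp. *)
Definition grpAlg_act (g : G) (z : grpAlg K aT) : grpAlg K aT :=
  [ffun x => g (z (x ^ (f g)^-1)%g)].

Definition grpAlg_coef (x : aT) (z : grpAlg K aT) : K := z x.

Fact grpAlg_act_is_linear g : linear (grpAlg_act g).
Proof. by move=> a u v; apply/ffunP=> x; rewrite !ffunE linearP. Qed.
HB.instance Definition _ g :=
  GRing.isLinear.Build k (grpAlg K aT) (grpAlg K aT) *:%R (grpAlg_act g)
    (grpAlg_act_is_linear g).

Fact grpAlg_coef_is_linear x : linear (grpAlg_coef x).
Proof. by move=> a u v; rewrite /grpAlg_coef !ffunE. Qed.
HB.instance Definition _ x :=
  GRing.isLinear.Build k (grpAlg K aT) K *:%R (grpAlg_coef x)
    (grpAlg_coef_is_linear x).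

(* E[M]^G inside K[aT], for G acting through f; see [mem_fixed_ring]. *)
Definition fixed_vspace (E : {vspace K}) (M : {set aT}) :
    {vspace grpAlg K aT} :=
  (\bigcap_(x in M) (linfun (grpAlg_coef x) @^-1: E) :&:
   \bigcap_(x in ~: M) lker (linfun (grpAlg_coef x)) :&:
   \bigcap_(g : G) fixedSpace (linfun (grpAlg_act g)))%VS.

Lemma mem_fixed_vspace (E : {vspace K}) (M : {set aT}) (z : grpAlg K aT) :
  reflect [/\ {in M, forall x, z x \in E},
              forall x, x \notin M -> z x = 0
            & forall g, grpAlg_act g z = z]
          (z \in fixed_vspace E M).
Proof.
rewrite !memv_cap -andbA; apply: (iffP and3P) => [[h1 h2 h3]|[h1 h2 h3]].
  split=> [x Mx | x M'x | g].
  - move: h1; rewrite memvE => /subv_bigcapP/(_ x Mx).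
    by rewrite -memvE -memv_preim lfunE.
  - move: h2; rewrite memvE => /subv_bigcapP/(_ x).
    by rewrite inE M'x -memvE memv_ker lfunE => /(_ isT)/eqP.
  move: h3; rewrite memvE => /subv_bigcapP/(_ g isT).
  by rewrite -memvE => /fixedSpaceP; rewrite lfunE.
split; rewrite memvE; apply/subv_bigcapP.
- by move=> x Mx; rewrite -memvE -memv_preim lfunE; exact: h1.
- by move=> x; rewrite inE -memvE memv_ker lfunE => /h2/eqP.
by move=> g _; rewrite -memvE; apply/fixedSpaceP; rewrite lfunE; exact: h3.
Qed.

Fact grpAlg_actM g : {morph grpAlg_act g : u v / u * v}.
Proof.
move=> u v; apply/ffunP=> x; rewrite !ffunE rmorph_sum /=.
rewrite (reindex_inj (conjg_inj (f g)^-1%g)) /=; apply: eq_bigr => y _.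
by rewrite !ffunE rmorphM -conjVg -conjMg.
Qed.

Fact grpAlg_act1 g : grpAlg_act g 1 = 1.
Proof.
by apply/ffunP=> x; rewrite !ffunE conjg_eq1 rmorph_nat.
Qed.

Variables (E : {subfield K}) (M : {group aT}).

Fact fixed_vspace_is_aspace : is_aspace (fixed_vspace E M).
Proof.
apply/andP; split.
  apply: has_algid1; apply/mem_fixed_vspace; split=> [x _|x|g].
  - by rewrite ffunE rpred_nat.
  - by rewrite ffunE; case: eqP => // ->; rewrite group1.
  exact: grpAlg_act1.
apply/prodvP=> u v /mem_fixed_vspace[u1 u2 u3] /mem_fixed_vspace[v1 v2 v3].
apply/mem_fixed_vspace; split=> [x Mx|x M'x|g].
- rewrite ffunE; apply: rpred_sum => y _.
  have [My | /u2->] := boolP (y \in M); last by rewrite mul0r rpred0.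
  by rewrite rpredM ?u1 ?v1 ?groupM ?groupV.
- rewrite ffunE big1 // => y _.
  have [My | /u2->] := boolP (y \in M); last by rewrite mul0r.
  by rewrite v2 ?mulr0 // groupMr ?groupV.
by rewrite grpAlg_actM u3 v3.
Qed.

Definition fixed_ring : {aspace grpAlg K aT} := ASpace fixed_vspace_is_aspace.

Lemma mem_fixed_ring (z : grpAlg K aT) :
  reflect [/\ {in M, forall x, z x \in E},
              forall x, x \notin M -> z x = 0
            & forall g, grpAlg_act g z = z]
          (z \in fixed_ring).
Proof. exact: mem_fixed_vspace. Qed.

End FixedRing.

Section Perm.
Variables (k : fieldType) (K : splittingFieldType k).
Local Notation G := (gal_of {:K}).
Implicit Types (N P : {group {perm G}}) (F : {subfield K}).

(* b |-> a o b; the composite of automorphisms a o b is b * a for MathComp. *)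
Definition lambda (a : G) : {perm G} := perm (mulIg a).

Definition lambdaG : {set {perm G}} := lambda @: [set: G].

Definition regular_perm (N : {set {perm G}}) : Prop :=
  [transitive N, on [set: G] | 'P]
  /\ forall b : G, 'C_N[b | 'P]%g = 1%g.

Definition H_sub (P : {group {perm G}}) : {aspace grpAlg K {perm G}} :=
  fixed_ring lambda {:K}%AS P.

Definition grpAlg_eval (h : grpAlg K {perm G}) (x : K) : K :=
  \sum_(n : {perm G}) h n * ((n^-1)%g 1%g : G) x.

Definition fixed_by (H : {vspace grpAlg K {perm G}}) (x : K) : Prop :=
  forall h, h \in H -> grpAlg_eval h x = aug h * x.

(* F[N/P]^G, where g acts by g on the coefficients and by conjugation by
   lambda g on N/P. When J = Gal(K/F) is normal in G this action factors
   through the quotient of lambda(G) by lambda(J), so this is the ring fixed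
   by that quotient. *)
Definition H_quot F N P : {aspace grpAlg K (coset_of P)} :=
  fixed_ring (fun g => coset P (lambda g)) F (N / P)%G.

Lemma lambdaM : {morph lambda : a b / (a * b)%g}.
Proof. by move=> a b; apply/permP=> c; rewrite permM !permE mulgA. Qed.

Lemma lambda1 : lambda 1%g = 1%g.
Proof. by apply/permP=> c; rewrite perm1 permE mulg1. Qed.

Lemma fixed_by_subfield_exists P : lambdaG \subset 'N(P)%g ->
  exists F : {subfield K}, forall x : K, x \in F <-> fixed_by (H_sub P) x.
Proof.
move=> nPG.
pose A : {set G} := [set (n : {perm G})^-1%g 1%g | n : {perm G} in P].
exists (@fixedField_aspace k K {:K}%AS A) => x; split=> [Fx h|Hx].
  have {}Fx : forall b : G, b \in A -> b x = x.
    by have [_] := mem_fixedFieldP Fx.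
  case/mem_fixed_ring=> _ hP _; rewrite /grpAlg_eval /aug mulr_suml.
  apply: eq_bigr => n _; have [Pn | /hP->] := boolP (n \in P).
    by rewrite Fx //; apply/imsetP; exists n.
  by rewrite !mul0r.
apply/fixedFieldP; first exact: memvf.
move=> _ /imsetP[n Pn ->].
pose c_ (b : G) : K := (((n ^ lambda b)^-1)%g 1%g : G) x - x.
suff /(_ 1%g isT) : forall b : G, predT b -> c_ b = 0.
  by rewrite /c_ lambda1 conjg1 => /eqP; rewrite subr_eq0 => /eqP.
apply: gal_independent => c _.
pose z : grpAlg K {perm G} :=
  [ffun m => \sum_(b : G) (m == (n ^ lambda b)%g)%:R * b c].
have /Hx : z \in H_sub P.
  apply/mem_fixed_ring; split=> [m _ | m P'm | g]; first exact: memvf.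
    rewrite ffunE big1 // => b _; case: eqP P'm => [-> | _]; last by rewrite mul0r.
    by rewrite memJ_norm ?Pn // (subsetP nPG) // imset_f ?inE.
  apply/ffunP=> m; rewrite !ffunE rmorph_sum [RHS](reindex_inj (mulIg g)) /=.
  apply: eq_bigr => b _; rewrite rmorphM rmorph_nat galM ?memvf //.
  by rewrite lambdaM conjgM (canF_eq (conjgKV _)).
have sumz (F : {perm G} -> K) :
    \sum_m z m * F m = \sum_(b : G) b c * F (n ^ lambda b)%g.
  under eq_bigr => m _ do rewrite ffunE mulr_suml.
  rewrite exchange_big; apply: eq_bigr => b _ /=.
  rewrite (bigD1 (n ^ lambda b)%g) //= eqxx mul1r big1 ?addr0 // => m.
  by move/negPf->; rewrite !mul0r.
rewrite /grpAlg_eval /aug mulr_suml !sumz => /eqP.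
rewrite -subr_eq0 -sumrB => /eqP e0; rewrite -[RHS]e0.
by apply: eq_bigr => b _; rewrite -mulrBr mulrC.
Qed.

End Perm.

(* Main.v *)
(* For n in N put theta(n) = n^-1(i_G). The map theta is a bijection from N onto
   G and satisfies theta(m) theta(n) = theta(m n'), with n' conjugate to n under
   lambda(theta(m)); hence theta(P) is a subgroup, J = theta(P), and theta induces
   a bijection from N/P to G/J = Gal(F/k) through which H_{N/P} acts on F.
   Galois descent shows that a k-basis (b_i) of H_{N/P} is also a basis of the
   space of K-valued functions on N/P. The form sending u, v to the sum of the
   u(x) v(x) is k-valued on H_{N/P}, which gives a dual basis (d_i) in H_{N/P};
   the comultiplication is then h |-> sum_i (h . d_i) (x) b_i for the pointwise
   product, and every identity in H_{N/P} (x) H_{N/P} is checked on coefficients.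
   Dedekind's independence of automorphisms makes the map from F # H_{N/P} to
   End_k(F) injective, and a dimension count makes it bijective. *)

Require Import Defs.
From HB Require Import structures.
From mathcomp Require Import all_boot all_order all_algebra all_fingroup.
From mathcomp Require Import all_solvable all_field.

Set Implicit Arguments.
Unset Strict Implicit.
Unset Printing Implicit Defensive.

Import GRing.Theory.
Local Open Scope ring_scope.

(** * Galois descent for fixed rings *)

Section DualBasis.
Variables (k : fieldType) (K : splittingFieldType k) (aT : finGroupType).
Local Notation G := (gal_of {:K}).
Variables (f : G -> aT) (E : {subfield K}) (M : {group aT}).
Hypothesis galK : galois 1 {:K}.
Hypothesis fM : {morph f : a b / (a * b)%g}.
Hypothesis nMf : forall g, f g \in 'N(M)%g.
Hypothesis fixE : forall z : grpAlg K aT,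
  (forall g, grpAlg_act f g z = z) -> {in M, forall x, z x \in E}.
Local Notation H := (fixed_ring f E M).

Lemma mem_base (a : K) : (forall g : G, g a = a) -> a \in 1%VS.
Proof.
move=> fixa; have /galois_fixedField <- := galK.
by apply/fixedFieldP => [|g _]; [exact: memvf | exact: fixa].
Qed.

(** Support and equivariance suffice for membership, since [fixE] makes the condition that the
    coefficients lie in E automatic. *)
Lemma mem_descent (z : grpAlg K aT) :
  (forall x, x \notin M -> z x = 0) ->
  (forall g x, z (x ^ f g)%g = g (z x)) -> z \in H.
Proof.
move=> zM zg.
have fixz g : grpAlg_act f g z = z.
  by apply/ffunP=> x; rewrite ffunE -zg conjgKV.
by apply/mem_fixed_ring; split=> //; exact: fixE.
Qed.

Lemma fixed_ring0 (z : grpAlg K aT) x : z \in H -> x \notin M -> z x = 0.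
Proof. by case/mem_fixed_ring=> _ zM _; exact: zM. Qed.

Lemma fixed_ringJ (z : grpAlg K aT) x g : z \in H -> z (x ^ f g)%g = g (z x).
Proof.
by case/mem_fixed_ring=> _ _ /(_ g)/ffunP/(_ (x ^ f g)%g); rewrite ffunE conjgK.
Qed.

Lemma memJ_descent x g : ((x ^ f g)%g \in M) = (x \in M).
Proof. by rewrite memJ_norm. Qed.

Lemma fixed_ring_pointwise (u v : grpAlg K aT) :
  u \in H -> v \in H -> [ffun x => u x * v x] \in H.
Proof.
move=> Hu Hv; apply: mem_descent => [x M'x | g x]; rewrite !ffunE.
  by rewrite (fixed_ring0 Hu) ?mul0r.
by rewrite !fixed_ringJ // rmorphM.
Qed.

Lemma fixed_ring_inv (u : grpAlg K aT) :
  u \in H -> [ffun x => u x^-1%g] \in H.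
Proof.
move=> Hu; apply: mem_descent => [x M'x | g x]; rewrite !ffunE.
  by rewrite (fixed_ring0 Hu) ?groupV.
by rewrite -conjVg fixed_ringJ.
Qed.

Lemma aug_fixed_ring (u : grpAlg K aT) : u \in H -> aug u \in 1%VS.
Proof.
move=> Hu; apply: mem_base => g; rewrite /aug rmorph_sum.
rewrite [RHS](reindex_inj (conjg_inj (f g))).
by apply: eq_bigr => x _; rewrite fixed_ringJ.
Qed.

(* Dedekind's independence, applied to the G-traces of the elements w m of K[M]. *)
Lemma fixed_ring_separates (c : aT -> K) :
  (forall h, h \in H -> \sum_x h x * c x = 0) -> {in M, forall m, c m = 0}.
Proof.
move=> Hc m Mm.
have f1 : f 1%g = 1%g by apply: (mulgI (f 1)%g); rewrite -fM !mulg1.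
have -> : c m = c (m ^ f 1)%g by rewrite f1 conjg1.
apply: (@gal_independent _ _ _ predT (fun g : G => c (m ^ f g)%g)) => // w _.
pose z : grpAlg K aT := [ffun x => \sum_(g : G) (x == (m ^ f g)%g)%:R * g w].
have /Hc : z \in H.
  apply: mem_descent => [x M'x | g x]; rewrite !ffunE.
    rewrite big1 // => g _; case: eqP M'x => [-> | _]; last by rewrite mul0r.
    by rewrite memJ_descent Mm.
  rewrite rmorph_sum (reindex_inj (mulIg g)); apply: eq_bigr => a _ /=.
  by rewrite rmorphM rmorph_nat fM conjgM galM ?memvf // (inj_eq (conjg_inj _)).
under eq_bigr => x _ do rewrite ffunE mulr_suml.
rewrite exchange_big => e0; rewrite -[RHS]e0; apply: eq_bigr => g _ /=.
rewrite (bigD1 (m ^ f g)%g) //= eqxx mul1r big1 ?addr0 1?mulrC // => x.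
by move/negPf->; rewrite !mul0r.
Qed.

Local Notation b := (vbasis {:subvs_of H}).

(** Freeness over k is upgraded to freeness over K. Multiplying a K-relation by w and summing over
    its G-translates gives a k-relation whose coefficients are the traces of [v i * w]; these vanish
    for all w, so Dedekind's independence kills [v i]. *)
Lemma fixed_ring_free (v : 'I_(\dim {:subvs_of H}) -> K) :
  (forall x, \sum_i v i * vsval b`_i x = 0) -> forall i, v i = 0.
Proof.
move=> v0 i.
suff /(_ 1%g isT) : forall g : G, predT g -> g (v i) = 0.
  by rewrite gal_id.
apply: gal_independent => w _.
pose t j := \sum_(g : G) g (v j) * g w.
have t1 j : t j \in 1%VS.
  apply: mem_base => g; rewrite /t rmorph_sum [RHS](reindex_inj (mulIg g)).
  by apply: eq_bigr => a _ /=; rewrite rmorphM !galM ?memvf.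
have /fin_all_exists[a ta] j : exists a : k, t j = a%:A by apply/vlineP/t1.
have : \sum_j a j *: b`_j = 0.
  apply: val_inj; rewrite /= linear_sum /=; apply/ffunP => x.
  rewrite sum_ffunE ffunE.
  (* Invariance rewrites the value of [b_j] at x as the image under g of its value at
     [x ^ (f g)^-1], which exhibits the sum as a combination of conjugates of the given relation. *)
  transitivity (\sum_(g : G) g w * g (\sum_j v j * vsval b`_j (x ^ (f g)^-1)%g)).
    under [RHS]eq_bigr => g _ do rewrite rmorph_sum mulr_sumr.
    rewrite exchange_big; apply: eq_bigr => j _.
    rewrite ffunE -mulr_algl -ta mulr_suml.
    apply: eq_bigr => g _.
    by rewrite rmorphM /= -fixed_ringJ ?subvsP // conjgKV mulrA [g w * _]mulrC.
  by apply: big1 => g _; rewrite v0 rmorph0 mulr0.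
have /freeP fb := basis_free (vbasisP {:subvs_of H}).
move/fb/(_ i) => a0; by rewrite -[LHS]/(t i) ta a0 scale0r.
Qed.

(** Descent for H amounts to the invertibility of this matrix: its rows are the k-basis of H as
    K-valued functions on M. *)
Definition evalmx : 'M[K]_(\dim {:subvs_of H}, #|M|) :=
  \matrix_(i, x) vsval b`_i (enum_val x).

Lemma evalmx_free : row_free evalmx.
Proof.
apply: inj_row_free => v v0; apply/rowP => i; rewrite mxE.
apply: fixed_ring_free i => x.
have [Mx | M'x] := boolP (x \in M); last first.
  by apply: big1 => i _; rewrite (fixed_ring0 (subvsP _)) ?mulr0.
move/rowP/(_ (enum_rank_in Mx x)): v0; rewrite !mxE => v0; rewrite -[RHS]v0.
by apply: eq_bigr => i _; rewrite mxE enum_rankK_in.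
Qed.

(** A relation between the columns is a linear functional on functions on M that vanishes on H,
    hence is zero by [fixed_ring_separates]. *)
Lemma evalmx_full : row_full evalmx.
Proof.
rewrite /row_full -mxrank_tr -/(row_free _).
apply: inj_row_free => v v0; apply/rowP => j; rewrite mxE.
(* This is the column vector v transported to aT and extended by 0 outside M. *)
pose c x : K := \sum_(l | enum_val l == x) v 0 l.
have <- : c (enum_val j) = v 0 j.
  rewrite /c (bigD1 j) //= big1 ?addr0 // => l /andP[/eqP/enum_val_inj->].
  by rewrite eqxx.
apply: fixed_ring_separates (enum_valP j) => h Hh.
have -> : h = vsval (Subvs Hh) by [].
have sumc (u : grpAlg K aT) : \sum_x u x * c x = \sum_l u (enum_val l) * v 0 l.
  under eq_bigr => x _ do rewrite mulr_sumr.
  rewrite (exchange_big_dep predT) //=; apply: eq_bigr => l _.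
  rewrite (big_pred1 (enum_val l)) // => x; exact: eq_sym.
rewrite sumc (coord_vbasis (memvf (Subvs Hh))) linear_sum.
under eq_bigr => l _ do rewrite sum_ffunE mulr_suml.
rewrite exchange_big big1 //= => i _.
move/rowP/(_ i): v0; rewrite !mxE => v0.
under eq_bigr => l _ do rewrite ffunE -scalerAl.
rewrite -scaler_sumr (_ : \sum_l _ = 0) ?scaler0 // -[RHS]v0.
by apply: eq_bigr => l _; rewrite !mxE mulrC.
Qed.

Lemma dim_fixed_ring : \dim {:subvs_of H} = #|M|.
Proof.
by rewrite -(eqP evalmx_full) (eqP evalmx_free).
Qed.

(* A dual basis for the nondegenerate form sending u, v to the sum of the
   u(x) v(x). *)
Lemma dual_basis_exists :
  exists d : 'I_(\dim {:subvs_of H}) -> subvs_of H,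
    {in M &, forall x y, \sum_i vsval (d i) x * vsval b`_i y = (x == y)%:R}.
Proof.
(* Being row free and row full, [evalmx] has a two-sided inverse; its columns are the dual basis,
   and both products are needed below. *)
have [D BD DB] : exists2 D, evalmx *m D = 1%:M & D *m evalmx = 1%:M.
  exists (pinvmx evalmx); [exact/mulmxVp/evalmx_free | exact/mulVpmx/evalmx_full].
pose e i : grpAlg K aT := [ffun x => \sum_(l | enum_val l == x) D l i].
have eE i l : e i (enum_val l) = D l i.
  rewrite ffunE (bigD1 l) //= big1 ?addr0 // => l' /andP[/eqP/enum_val_inj->].
  by rewrite eqxx.
have eb : {in M &, forall x y, \sum_i e i x * vsval b`_i y = (x == y)%:R}.
  move=> x y Mx My.
  have <- := enum_rankK_in Mx Mx; have <- := enum_rankK_in Mx My.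
  have /matrixP/(_ (enum_rank_in Mx x) (enum_rank_in Mx y))  := DB.
  rewrite (inj_eq enum_val_inj) !mxE => <-.
  by apply: eq_bigr => i _; rewrite !mxE eE.
have be (i j : 'I_(\dim {:subvs_of H})) :
    \sum_(x in M) vsval b`_i x * e j x = (i == j)%:R.
  have /matrixP/(_ i j) := BD.
  rewrite !mxE => <-; rewrite big_enum_val /=.
  by apply: eq_bigr => l _; rewrite !mxE eE.
have He i : e i \in H.
  apply: mem_descent => [x M'x | g x].
    rewrite ffunE big1 // => l /eqP xl; case/negP: M'x; rewrite -xl.
    exact: enum_valP.
  have [Mx | M'x] := boolP (x \in M); last first.
    rewrite !ffunE !big1 ?rmorph0 // => l /eqP xl; case/negP: M'x.
      by rewrite -xl enum_valP.
    by rewrite -(memJ_descent x g) -xl enum_valP.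
  (* Equivariance of the dual basis: summing over j first, [eb] leaves the value of [e i] at
     [x ^ f g]; summing over y first, equivariance of the [b_j] and [be] leave [g (e i x)]. *)
  transitivity (\sum_(y in M) \sum_j g (e j x * vsval b`_j y) * e i (y ^ f g)%g).
    rewrite (bigD1 x) //= [X in _ + X]big1 ?addr0 => [|y /andP[My xy]]; last first.
      rewrite -mulr_suml -rmorph_sum eb // eq_sym (negPf xy) rmorph0.
      by rewrite mul0r.
    by rewrite -mulr_suml -rmorph_sum eb // eqxx rmorph1 mul1r.
  rewrite exchange_big /=.
  transitivity (\sum_j g (e j x) * (j == i)%:R).
    apply: eq_bigr => j _; rewrite -be mulr_sumr.
    rewrite [RHS](reindex_inj (conjg_inj (f g))) /=.
    rewrite [RHS](eq_bigl _ _ (fun y => memJ_descent y g)).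
    apply: eq_bigr => y _.
    by rewrite rmorphM (fixed_ringJ _ _ (subvsP _)) mulrA.
  rewrite (bigD1 i) //= eqxx mulr1 big1 ?addr0 // => j /negPf->.
  by rewrite mulr0.
by exists (fun i => Subvs (He i)).
Qed.

End DualBasis.

(** * The inherited Hopf structure *)

Section TensorLinearity.
Variables (k : fieldType) (U V : vectType k).

Lemma ptens_linearl (v : V) : linear (ptens^~ v : U -> tens U V).
Proof. by move=> a u u'; apply/matrixP=> i j; rewrite !mxE linearP mulrDl mulrA. Qed.

Lemma linear_tens_lift (W X : lmodType k) (g : {linear W -> X})
    (beta : U -> V -> W) t :
  g (tens_lift beta t) = tens_lift (fun u v => g (beta u v)) t.
Proof.
rewrite /tens_lift linear_sum; apply: eq_bigr => i _; rewrite linear_sum.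
by apply: eq_bigr => j _; rewrite linearZ.
Qed.

Lemma eq_tens_lift (W : lmodType k) (beta gamma : U -> V -> W) :
  beta =2 gamma -> tens_lift beta =1 tens_lift gamma.
Proof.
by move=> eb t; apply: eq_bigr => i _; apply: eq_bigr => j _; rewrite eb.
Qed.

Lemma tens_lift_sum (W : lmodType k) (I : finType) (beta : I -> U -> V -> W) t :
  tens_lift (fun u v => \sum_i beta i u v) t = \sum_i tens_lift (beta i) t.
Proof.
rewrite [RHS]exchange_big; apply: eq_bigr => i _ /=.
by rewrite [RHS]exchange_big; apply: eq_bigr => j _; rewrite scaler_sumr.
Qed.

Lemma tens_lift_mull (A : algType k) (c : A) (beta : U -> V -> A) t :
  tens_lift (fun u v => c * beta u v) t = c * tens_lift beta t.
Proof.
rewrite /tens_lift mulr_sumr; apply: eq_bigr => i _; rewrite mulr_sumr.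
by apply: eq_bigr => j _; rewrite scalerAr.
Qed.

End TensorLinearity.

Section DiagonalHopf.
Variables (k : fieldType) (K : fieldExtType k) (aT : finGroupType).
Variable H : {aspace grpAlg K aT}.
Hypothesis H1 : 1 \in H.
Hypothesis Hpw :
  forall u v : grpAlg K aT, u \in H -> v \in H -> [ffun x => u x * v x] \in H.
Hypothesis Hinv : forall u : grpAlg K aT, u \in H -> [ffun x => u x^-1%g] \in H.
Hypothesis Haug : forall u, u \in H -> aug u \in 1%VS.
Local Notation B := (subvs_of H).
Local Notation b := (vbasis {:B}).
Hypothesis Hfree : forall v : 'I_(\dim {:B}) -> K,
  (forall x, \sum_i v i * vsval b`_i x = 0) -> forall i, v i = 0.
Variable d : 'I_(\dim {:B}) -> B.
(** In a fixed ring the duality relation holds only on M; the factor h(x), which vanishes off M,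
    makes it valid on all of aT. *)
Hypothesis Hdual : forall (h : B) x y,
  \sum_i vsval h x * (vsval (d i) x * vsval b`_i y) = if x == y then vsval h x else 0.

Lemma algidE : algid H = 1.
Proof. by apply/eqP; rewrite algid_eq1. Qed.

Lemma vsval1 : vsval (1 : B) = 1.
Proof. exact: algidE. Qed.

Lemma vsvalM (u v : B) : vsval (u * v) = vsval u * vsval v.
Proof. by []. Qed.

Lemma coefP (a : k) (u v : B) x :
  vsval (a *: u + v) x = a *: vsval u x + vsval v x.
Proof. by rewrite linearP !ffunE. Qed.

Definition pointwise (u v : B) : B := Subvs (Hpw (subvsP u) (subvsP v)).

Lemma pointwiseE u v x : vsval (pointwise u v) x = vsval u x * vsval v x.
Proof. by rewrite ffunE. Qed.

Lemma pointwise_linearl v : linear (pointwise^~ v).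
Proof.
move=> a u u'; apply/val_inj/ffunP=> x.
by rewrite coefP !pointwiseE coefP mulrDl scalerAl.
Qed.

(* The only element of B (x) B whose coefficient at x (x) y is h(x) if x = y
   and 0 otherwise. *)
Definition diag_comul (h : B) : tens B B := \sum_j ptens (pointwise h (d j)) b`_j.

Fact diag_comul_is_linear : linear diag_comul.
Proof.
move=> a u v; rewrite /diag_comul scaler_sumr -big_split; apply: eq_bigr => j _ /=.
by rewrite pointwise_linearl ptens_linearl.
Qed.
HB.instance Definition _ :=
  GRing.isLinear.Build k B (tens B B) *:%R diag_comul diag_comul_is_linear.

Lemma tens_lift_comul (W : lmodType k) (beta : B -> B -> W) h :
  (forall u, linear (beta u)) -> (forall v, linear (beta^~ v)) ->
  tens_lift beta (diag_comul h) = \sum_j beta (pointwise h (d j)) b`_j.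
Proof.
by move=> lr ll; rewrite linear_sum; apply: eq_bigr => j _; apply: tens_liftE.
Qed.

(** This is the coefficient of x (x) y in the image of the tensor in K[aT] (x) K[aT], taken over
    K. *)
Definition tens_eval x y : tens B B -> K :=
  tens_lift (fun u v : B => vsval u x * vsval v y).
HB.instance Definition _ x y := GRing.Linear.on (tens_eval x y).

Lemma tens_eval_ptens x y (u v : B) :
  tens_eval x y (ptens u v) = vsval u x * vsval v y.
Proof.
apply: (tens_liftE (beta := fun u v : B => vsval u x * vsval v y)) => {u v} w a u v.
  by rewrite coefP mulrDr scalerAr.
by rewrite coefP mulrDl scalerAl.
Qed.

Lemma tens_eval_comul h x y :
  tens_eval x y (diag_comul h) = if x == y then vsval h x else 0.
Proof.
rewrite linear_sum /= -Hdual; apply: eq_bigr => j _.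
by rewrite tens_eval_ptens pointwiseE mulrA.
Qed.

(** [Hfree] strips off the factor B, because the values of the [psi i] are K-coefficients of a
    relation between the [b_i]; the family [psi] then separates V. The general V serves B (x) B and,
    for coassociativity, B (x) (B (x) B). *)
Lemma tens_separated (V : vectType k) (I : Type) (psi : I -> {linear V -> K}) :
  (forall v, (forall i, psi i v = 0) -> v = 0) ->
  forall t : tens B V,
  (forall x i, tens_lift (fun (u : B) v => vsval u x * psi i v) t = 0) -> t = 0.
Proof.
move=> psi_inj t t0; apply/matrixP => i j; rewrite mxE.
have /freeP fV := basis_free (vbasisP {:V}); move: j; apply: fV.
apply: psi_inj => l.
rewrite linear_sum; under eq_bigr => j _ do rewrite linearZ /=.
move: i; apply: (@Hfree (fun i => \sum_j t i j *: psi l (vbasis {:V})`_j)) => x.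
rewrite -[RHS](t0 x l); apply: eq_bigr => i _; rewrite mulr_suml.
by apply: eq_bigr => j _; rewrite -scalerAl mulrC.
Qed.

Lemma tens_eval_inj (s t : tens B B) :
  (forall x y, tens_eval x y s = tens_eval x y t) -> s = t.
Proof.
move=> est; apply/eqP; rewrite -subr_eq0; apply/eqP.
pose cf (y : aT) (v : B) := vsval v y.
have lcf y : linear (cf y) by move=> a u v; apply: coefP.
pose mcf y := GRing.isLinear.Build k B K *:%R (cf y) (lcf y).
pose psi y : {linear B -> K} := HB.pack (cf y) (mcf y).
apply: (@tens_separated B aT psi) => [v v0 | x y].
  by apply/val_inj/ffunP => y; rewrite [LHS]v0 ffunE.
by rewrite -[LHS]/(tens_eval x y (s - t)) linearB /= est subrr.
Qed.

(** By [Haug] the augmentation is a k-multiple of 1, and the coordinate along the one-vector family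
    1 recovers the scalar. *)
Definition diag_counit (h : B) : k^o := coord [tuple 1 : K] 0 (aug (vsval h)).

Fact diag_counit_is_linear : linear diag_counit.
Proof.
move=> a u v; rewrite /diag_counit.
suff <- : a *: aug (vsval u) + aug (vsval v) = aug (vsval (a *: u + v)).
  by rewrite linearP.
rewrite /aug scaler_sumr -big_split; apply: eq_bigr => x _; exact/esym/coefP.
Qed.
HB.instance Definition _ :=
  GRing.isLinear.Build k B k^o *:%R diag_counit diag_counit_is_linear.

Lemma diag_counitE h : diag_counit h *: 1 = aug (vsval h).
Proof.
have : aug (vsval h) \in <<[tuple 1%R : K]>>%VS by rewrite span_seq1 Haug ?subvsP.
by move/coord_span; rewrite big_ord1.
Qed.

Lemma scaler1_inj : injective (fun a : k => a *: (1 : K)).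
Proof. exact: (fmorph_inj (in_alg K)). Qed.

Definition diag_antipode (h : B) : B := Subvs (Hinv (subvsP h)).

Lemma diag_antipodeE h x : vsval (diag_antipode h) x = vsval h x^-1%g.
Proof. by rewrite ffunE. Qed.

Fact diag_antipode_is_linear : linear diag_antipode.
Proof.
move=> a u v; apply/val_inj/ffunP=> x.
by rewrite coefP !diag_antipodeE coefP.
Qed.
HB.instance Definition _ :=
  GRing.isLinear.Build k B B *:%R diag_antipode diag_antipode_is_linear.

(** Seen through coefficients, B (x) B multiplies as the group algebra of aT x aT, that is, by
    convolution. *)
Lemma tens_eval_mul x y (s t : tens B B) :
  tens_eval x y (tens_mul s t)
  = \sum_u \sum_v tens_eval u v s * tens_eval (x * u^-1)%g (y * v^-1)%g t.
Proof.
rewrite linear_tens_lift /=.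
transitivity (tens_lift (fun p q : B => \sum_u \sum_v
    tens_eval (x * u^-1)%g (y * v^-1)%g t * (vsval p u * vsval q v)) s); last first.
  rewrite tens_lift_sum; apply: eq_bigr => u _.
  rewrite tens_lift_sum; apply: eq_bigr => v _.
  by rewrite tens_lift_mull mulrC.
apply: eq_tens_lift => p q; rewrite linear_tens_lift /=.
transitivity (tens_lift (fun p' q' : B => \sum_u \sum_v (vsval p u * vsval q v) *
    (vsval p' (x * u^-1)%g * vsval q' (y * v^-1)%g)) t).
  apply: eq_tens_lift => p' q'; rewrite tens_eval_ptens !vsvalM !ffunE mulr_suml.
  apply: eq_bigr => u _; rewrite mulr_sumr; apply: eq_bigr => v _.
  by rewrite mulrACA.
rewrite tens_lift_sum; apply: eq_bigr => u _.
rewrite tens_lift_sum; apply: eq_bigr => v _.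
by rewrite tens_lift_mull mulrC.
Qed.

Fact diag_comul1 : diag_comul 1 = ptens 1 1.
Proof.
apply: tens_eval_inj => x y; rewrite tens_eval_comul tens_eval_ptens vsval1 !ffunE.
case: (x =P y) => [<- | xy]; first by rewrite -natrM mulnb andbb.
by case: eqP xy => [-> | _ _]; rewrite ?mul0r // mul1r eq_sym; case: eqP.
Qed.

Fact diag_comulM g h : diag_comul (g * h) = tens_mul (diag_comul g) (diag_comul h).
Proof.
apply: tens_eval_inj => x y; rewrite tens_eval_comul tens_eval_mul vsvalM ffunE.
transitivity (\sum_u vsval g u * if x == y then vsval h (x * u^-1)%g else 0).
  by case: eqP => _ //; rewrite big1 // => u _; rewrite mulr0.
apply: eq_bigr => u _; rewrite (bigD1 u) //= big1 => [|v uv].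
  by rewrite addr0 !tens_eval_comul eqxx (inj_eq (mulIg _)).
by rewrite tens_eval_comul eq_sym (negPf uv) mul0r.
Qed.

Fact diag_comulA h :
  tens_lift (fun u v => ptens u (diag_comul v)) (diag_comul h)
  = tens_lift (fun u v =>
      tens_lift (fun c e => ptens c (ptens e v)) (diag_comul u)) (diag_comul h)
    :> tens B (tens B B).
Proof.
pose eval3 x yz : tens B (tens B B) -> K :=
  tens_lift (fun (u : B) t => vsval u x * tens_eval yz.1 yz.2 t).
have eval3E x yz u t : eval3 x yz (ptens u t) = vsval u x * tens_eval yz.1 yz.2 t.
  apply: (tens_liftE (beta := fun u t => _)) => {u t} w a u v.
    by rewrite linearP mulrDr scalerAr.
  by rewrite coefP mulrDl scalerAl.
apply/eqP; rewrite -subr_eq0; apply/eqP.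
apply: (@tens_separated (tens B B) (aT * aT) (fun yz => tens_eval yz.1 yz.2)).
  by move=> t t0; apply: tens_eval_inj => x y; rewrite linear0 (t0 (x, y)).
move=> x [y z]; apply/eqP; rewrite linearB subr_eq0 /=; apply/eqP.
rewrite -!/(eval3 x (y, z) _) [LHS]linear_tens_lift [RHS]linear_tens_lift /=.
(* The common coefficient at x (x) y (x) z is h(x) if x = y = z and 0 otherwise. The inner
   comultiplication forces y = z on the left and x = y on the right. *)
transitivity (if y == z then tens_eval x y (diag_comul h) else 0).
  transitivity (tens_lift (fun u v : B =>
    (y == z)%:R * (vsval u x * vsval v y)) (diag_comul h)).
    apply: eq_tens_lift => u v; rewrite [LHS](eval3E x (y, z)) tens_eval_comul.
    by case: eqP => _; rewrite ?mul1r // mul0r mulr0.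
  by rewrite tens_lift_mull; case: eqP => _; rewrite ?mul1r ?mul0r.
transitivity (if x == y then tens_eval x z (diag_comul h) else 0).
  rewrite !tens_eval_comul.
  by case: (x =P y) => [->|_]; case: (y == z).
transitivity (tens_lift (fun u v : B =>
    (x == y)%:R * (vsval u x * vsval v z)) (diag_comul h)).
  by rewrite tens_lift_mull; case: eqP => _; rewrite ?mul1r ?mul0r.
apply: eq_tens_lift => u v; rewrite linear_tens_lift.
transitivity (tens_lift (fun c e : B =>
    vsval v z * (vsval c x * vsval e y)) (diag_comul u)).
  rewrite tens_lift_mull [tens_lift _ _]tens_eval_comul.
  by case: eqP => _; rewrite ?mul1r ?mul0r ?mulr0 // mulrC.
apply: eq_tens_lift => c e; rewrite [RHS](eval3E x (y, z)) tens_eval_ptens.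
by rewrite [LHS]mulrC mulrA.
Qed.

Fact diag_counit1 : diag_counit 1 = 1.
Proof.
apply: scaler1_inj; rewrite /= diag_counitE vsval1 /aug scale1r.
rewrite (bigD1 1%g) //= big1 => [|x /negPf x1]; rewrite ffunE ?eqxx ?addr0 //.
by rewrite x1.
Qed.

Fact diag_counitM g h : diag_counit (g * h) = diag_counit g * diag_counit h.
Proof.
apply: scaler1_inj; rewrite /= diag_counitE vsvalM -scalerA diag_counitE.
rewrite -mulr_algl diag_counitE /aug mulr_suml.
under eq_bigr => x _ do rewrite ffunE.
rewrite exchange_big; apply: eq_bigr => u _; rewrite -mulr_sumr.
by rewrite (reindex_inj (mulIg u)); under eq_bigr => x _ do rewrite /= mulgK.
Qed.

(** Expanding the counit as a sum over x, [Hdual] keeps only the term x = y in the coefficient at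
    y. *)
Fact diag_counitl h :
  tens_lift (fun u v => diag_counit u *: v) (diag_comul h) = h.
Proof.
rewrite tens_lift_comul => [|u a v v'|v a u u']; last 2 first.
- by rewrite scalerDr !scalerA mulrC.
- by rewrite linearP scalerDl scalerA.
apply/val_inj/ffunP => y; rewrite linear_sum sum_ffunE.
transitivity (\sum_x \sum_i vsval h x * (vsval (d i) x * vsval b`_i y)).
  rewrite exchange_big; apply: eq_bigr => i _ /=.
  rewrite ffunE -mulr_algl diag_counitE mulr_suml.
  by apply: eq_bigr => x _; rewrite pointwiseE mulrA.
rewrite (bigD1 y) //= Hdual eqxx big1 ?addr0 // => x /negPf xy.
by rewrite Hdual xy.
Qed.

Fact diag_counitr h :
  tens_lift (fun u v => diag_counit v *: u) (diag_comul h) = h.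
Proof.
rewrite tens_lift_comul => [|u a v v'|v a u u']; last 2 first.
- by rewrite linearP scalerDl scalerA.
- by rewrite scalerDr !scalerA mulrC.
apply/val_inj/ffunP => x; rewrite linear_sum sum_ffunE.
transitivity (\sum_y \sum_i vsval h x * (vsval (d i) x * vsval b`_i y)).
  rewrite exchange_big; apply: eq_bigr => i _ /=.
  rewrite ffunE -mulr_algl diag_counitE mulr_suml.
  by apply: eq_bigr => y _; rewrite pointwiseE mulrC mulrA.
rewrite (bigD1 x) //= Hdual eqxx big1 ?addr0 // => y /negPf xy.
by rewrite Hdual eq_sym xy.
Qed.

(** In the coefficient at z, [Hdual] compares y^-1 with z y^-1. They agree only for z = 1, where the
    sum of the h(y^-1) is the augmentation of h. *)
Fact diag_antipodel h :
  tens_lift (fun u v => diag_antipode u * v) (diag_comul h)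
  = (diag_counit h : k) *: 1.
Proof.
rewrite tens_lift_comul => [|u a v v'|v a u u']; last 2 first.
- by rewrite mulrDr scalerAr.
- by rewrite linearP mulrDl scalerAl.
apply/val_inj/ffunP => z; rewrite linear_sum sum_ffunE linearZ /= algidE.
transitivity (\sum_y \sum_i vsval h y^-1%g
    * (vsval (d i) y^-1%g * vsval b`_i (z * y^-1)%g)).
  rewrite exchange_big; apply: eq_bigr => i _ /=.
  by rewrite ffunE; apply: eq_bigr => y _; rewrite !ffunE mulrA.
rewrite !ffunE -mulr_algl diag_counitE mulr_suml [RHS](reindex_inj invg_inj).
apply: eq_bigr => y _ /=; rewrite Hdual -[X in X == _]mul1g (inj_eq (mulIg _)).
by rewrite eq_sym; case: eqP => _; rewrite ?mulr1 ?mulr0.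
Qed.

Fact diag_antipoder h :
  tens_lift (fun u v => u * diag_antipode v) (diag_comul h)
  = (diag_counit h : k) *: 1.
Proof.
rewrite tens_lift_comul => [|u a v v'|v a u u']; last 2 first.
- by rewrite linearP mulrDr scalerAr.
- by rewrite mulrDl scalerAl.
apply/val_inj/ffunP => z; rewrite linear_sum sum_ffunE linearZ /= algidE.
transitivity (\sum_y \sum_i vsval h y * (vsval (d i) y * vsval b`_i (z * y^-1)^-1%g)).
  rewrite exchange_big; apply: eq_bigr => i _ /=.
  by rewrite ffunE; apply: eq_bigr => y _; rewrite !ffunE mulrA.
rewrite !ffunE -mulr_algl diag_counitE mulr_suml.
apply: eq_bigr => y _ /=; rewrite Hdual invMg invgK.
rewrite -[X in X == _]mulg1 (inj_eq (mulgI _)) eq_sym invg_eq1.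
by case: eqP => _; rewrite ?mulr1 ?mulr0.
Qed.

Definition diag_hopf : hopf_structure B :=
  {| comul := diag_comul; counit := diag_counit; antipode := diag_antipode;
     comul1 := diag_comul1; comulM := diag_comulM; counit1 := diag_counit1;
     counitM := diag_counitM; comulA := diag_comulA; counitl := diag_counitl;
     counitr := diag_counitr; antipodel := diag_antipodel;
     antipoder := diag_antipoder |}.

Lemma diag_hopf_inherited : inherited_hopf diag_hopf.
Proof.
split=> [h x y | h | h x].
- exact: tens_eval_comul.
- exact: diag_counitE.
- exact: diag_antipodeE.
Qed.

End DiagonalHopf.

Lemma fixed_ring1 (k : fieldType) (K : splittingFieldType k) (aT : finGroupType)
    (f : gal_of {:K} -> aT) (E : {subfield K}) (M : {group aT}) :
  1 \in fixed_ring f E M.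
Proof.
apply/mem_fixed_ring; split=> [x _ | x | g]; last exact: grpAlg_act1.
  by rewrite ffunE rpred_nat.
by rewrite ffunE; case: eqP => // ->; rewrite group1.
Qed.

Lemma fixed_ring_hopf_exists (k : fieldType) (K : splittingFieldType k)
    (aT : finGroupType) (f : gal_of {:K} -> aT) (E : {subfield K}) (M : {group aT}) :
  galois 1 {:K} -> {morph f : a b / (a * b)%g} ->
  (forall g, f g \in 'N(M)%g) ->
  (forall z : grpAlg K aT, (forall g, grpAlg_act f g z = z) ->
    {in M, forall x, z x \in E}) ->
  exists S : hopf_structure (subvs_of (fixed_ring f E M)), inherited_hopf S.
Proof.
move=> galK fM nMf fixE; have [d dE] := dual_basis_exists galK fM nMf fixE.
have Hdual (h : subvs_of (fixed_ring f E M)) x y :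
    \sum_i vsval h x
       * (vsval (d i) x * vsval (vbasis {:subvs_of (fixed_ring f E M)})`_i y)
    = if x == y then vsval h x else 0.
  have [Mx | M'x] := boolP (x \in M); last first.
    by rewrite (fixed_ring0 (subvsP h) M'x) big1 ?if_same // => i _; rewrite mul0r.
  have [My | M'y] := boolP (y \in M); last first.
    rewrite big1 => [|i _]; last by rewrite (fixed_ring0 (subvsP _) M'y) !mulr0.
    by case: eqP => // xy; rewrite -xy Mx in M'y.
  by rewrite -mulr_sumr dE //; case: eqP => _; rewrite ?mulr1 ?mulr0.
exists (diag_hopf (fixed_ring1 f E M) (fixed_ring_pointwise fixE)
  (fixed_ring_inv fixE) (aug_fixed_ring galK (M := M)) (fixed_ring_free galK (M := M))
  Hdual).
exact: diag_hopf_inherited.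
Qed.

(** * Hopf-Galois actions *)

Section DiagonalAction.
Variables (k : fieldType) (K : splittingFieldType k) (aT : finGroupType).
Local Notation G := (gal_of {:K}).
Variables (H : {aspace grpAlg K aT}) (S : hopf_structure (subvs_of H)).
Hypothesis SH : inherited_hopf S.
Variables (M : {set aT}) (F : {subfield K}) (e : aT -> G).
Local Notation B := (subvs_of H).
Local Notation L := (subvs_of F).
Local Notation b := (vbasis {:B}).

Definition diag_act (h : grpAlg K aT) (x : K) : K := \sum_t h t * e t x.

Hypothesis H1 : 1 \in H.
Hypothesis HM : forall h x, h \in H -> x \notin M -> h x = 0.
Hypothesis Hfree : forall v : 'I_(\dim {:B}) -> K,
  (forall x, \sum_i v i * vsval b`_i x = 0) -> forall i, v i = 0.
Hypothesis Hdim : \dim {:B} = \dim F.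
Hypothesis Hsep : forall c : aT -> K,
  (forall h, h \in H -> \sum_x h x * c x = 0) -> {in M, forall m, c m = 0}.
Hypothesis e1 : {in F, forall x, e 1%g x = x}.
Hypothesis actF : forall h x, h \in H -> x \in F -> diag_act h x \in F.
Hypothesis actM : forall g h x, g \in H -> h \in H -> x \in F ->
  diag_act (g * h) x = diag_act g (diag_act h x).
Hypothesis act_indep : forall c : grpAlg K aT, {in [predC M], forall x, c x = 0} ->
  (forall y, y \in F -> diag_act c y = 0) -> forall x, c x = 0.
Hypothesis act_fix : forall x, x \in F -> {in M, forall t, e t x = x} -> x \in 1%VS.

Lemma diag_act_linear h : linear (diag_act h).
Proof.
move=> a x y; rewrite /diag_act scaler_sumr -big_split; apply: eq_bigr => t _ /=.
by rewrite linearP mulrDr scalerAr.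
Qed.

Lemma diag_act_linearl x : linear (diag_act^~ x).
Proof.
move=> a u v; rewrite /diag_act scaler_sumr -big_split; apply: eq_bigr => t _ /=.
by rewrite !ffunE mulrDl scalerAl.
Qed.

(** By [actF] the value already lies in F, so the projection [vsproj] only changes its type. *)
Definition act_fun (h : B) (x : L) : L := vsproj F (diag_act (vsval h) (vsval x)).

Lemma act_funE h x : vsval (act_fun h x) = diag_act (vsval h) (vsval x).
Proof. by rewrite vsprojK ?actF ?subvsP. Qed.

Fact act_fun_is_linear h : linear (act_fun h).
Proof.
move=> a x y; apply: subvs_inj.
by rewrite act_funE linearP diag_act_linear -!act_funE -linearP.
Qed.
HB.instance Definition _ h :=
  GRing.isLinear.Build k L L *:%R (act_fun h) (act_fun_is_linear h).

Definition act_end (h : B) : 'End(L) := linfun (act_fun h).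

Lemma act_endE h x : vsval (act_end h x) = diag_act (vsval h) (vsval x).
Proof. by rewrite lfunE act_funE. Qed.

Fact act_end_is_linear : linear act_end.
Proof.
move=> a u v; apply/lfunP => x; apply: subvs_inj.
by rewrite act_endE linearP diag_act_linearl -!act_endE -linearP !lfun_simp.
Qed.
HB.instance Definition _ :=
  GRing.isLinear.Build k B 'End(L) *:%R act_end act_end_is_linear.

Lemma lfun_tens_lift (U V W X : vectType k) (beta : U -> V -> 'Hom(W, X)) t z :
  tens_lift beta t z = tens_lift (fun u v => beta u v z) t.
Proof.
rewrite sum_lfunE; apply: eq_bigr => i _; rewrite sum_lfunE.
by apply: eq_bigr => j _; rewrite scale_lfunE.
Qed.

Lemma act_end1 : act_end 1 = \1%VF.
Proof.
apply/lfunP => x; apply: subvs_inj; rewrite act_endE vsval1 // id_lfunE.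
rewrite /diag_act (bigD1 1%g) //= big1 => [|y /negPf y1]; rewrite ffunE ?eqxx.
  by rewrite addr0 mul1r e1 ?subvsP.
by rewrite y1 mul0r.
Qed.

Lemma act_endM g h : act_end (g * h) = (act_end g \o act_end h)%VF.
Proof.
apply/lfunP => x; apply: subvs_inj.
by rewrite comp_lfunE !act_endE -actM ?subvsP.
Qed.

(** Each [e t] is multiplicative, and the coefficients of [comul S h] vanish off the diagonal. *)
Lemma act_end_measure h x y :
  act_end h (x * y)
  = tens_lift (fun h1 h2 => act_end h1 x * act_end h2 y) (comul S h).
Proof.
have [comulE _ _] := SH; apply: subvs_inj; rewrite act_endE linear_tens_lift.
transitivity (tens_lift (fun h1 h2 : B => \sum_s \sum_t
    e s (vsval x) * e t (vsval y) * (vsval h1 s * vsval h2 t)) (comul S h)).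
  rewrite tens_lift_sum; apply: eq_bigr => s _; rewrite tens_lift_sum.
  rewrite (bigD1 s) //= tens_lift_mull comulE eqxx big1 => [|t ts]; last first.
    by rewrite tens_lift_mull comulE eq_sym (negPf ts) mulr0.
  by rewrite addr0 /= rmorphM mulrC.
apply: eq_tens_lift => h1 h2; rewrite /= !act_endE mulr_suml.
apply: eq_bigr => s _; rewrite mulr_sumr; apply: eq_bigr => t _.
by rewrite mulrC mulrACA.
Qed.

Lemma counit_act h (x : L) : vsval ((counit S h : k) *: x) = aug (vsval h) * vsval x.
Proof. by have [_ <- _] := SH; rewrite linearZ mulr_algl. Qed.

Lemma act_end_unit h : act_end h 1 = (counit S h : k) *: 1.
Proof.
apply: subvs_inj; rewrite act_endE counit_act mulr_suml.
by apply: eq_bigr => t _; rewrite (_ : vsval 1 = 1) ?rmorph1 // -[LHS]/(algid F) algid1.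
Qed.

(** For a fixed x, every h in H kills the function t |-> e t x - x, so [Hsep] gives e t x = x on M
    and [act_fix] concludes. *)
Lemma act_end_fixed (x : L) :
  (forall h, act_end h x = (counit S h : k) *: x) <-> x \in 1%VS.
Proof.
split=> [fix_x | /vlineP[a ->] h]; last first.
  by rewrite linearZ /= act_end_unit scalerA mulrC -scalerA.
have /act_fix : vsval x \in F := subvsP x.
case/(_ _)/vlineP => [|a xa]; last first.
  apply/vlineP; exists a; apply: subvs_inj; rewrite /= xa.
  by rewrite algid1.
move=> t Mt; apply/eqP; rewrite -subr_eq0; apply/eqP; move: t Mt.
apply: Hsep => h Hh.
have := congr1 vsval (fix_x (Subvs Hh)).
rewrite act_endE counit_act => /eqP; rewrite -subr_eq0 mulr_suml -sumrB => /eqP h0.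
by rewrite -[RHS]h0; apply: eq_bigr => t _; rewrite mulrBr.
Qed.

Local Notation mu := act_end.

Lemma smash_mapE s z : smash_map mu s z = tens_lift (fun x h => x * mu h z) s.
Proof.
rewrite lfun_tens_lift; apply: eq_tens_lift => x h.
by rewrite comp_lfunE lfunE.
Qed.

Lemma smash_map_ptens x h z : smash_map mu (ptens x h) z = x * mu h z.
Proof.
rewrite smash_mapE tens_liftE // => [u | v] a w w'.
  by rewrite linearP !lfun_simp mulrDr scalerAr.
by rewrite mulrDl scalerAl.
Qed.

Lemma smash_map_lift (U V : vectType k) (beta : U -> V -> tens L B) t z :
  smash_map mu (tens_lift beta t) z
  = tens_lift (fun u v => smash_map mu (beta u v) z) t.
Proof. by rewrite /smash_map linear_tens_lift lfun_tens_lift. Qed.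

(** On pure tensors this is the measuring identity for mu h applied to the product of y and mu g
    z. *)
Lemma smash_map_mul s t :
  smash_map mu (smash_mul S mu s t) = (smash_map mu s \o smash_map mu t)%VF.
Proof.
apply/lfunP => z; rewrite comp_lfunE [RHS]smash_mapE [LHS]smash_map_lift.
apply: eq_tens_lift => x h; rewrite [smash_map mu t z]smash_mapE.
rewrite [mu h _]linear_tens_lift -tens_lift_mull [LHS]smash_map_lift.
apply: eq_tens_lift => y g; rewrite /= act_end_measure -tens_lift_mull.
rewrite [LHS]smash_map_lift; apply: eq_tens_lift => h1 h2.
by rewrite [LHS]smash_map_ptens act_endM comp_lfunE mulrA.
Qed.

(** Writing s as the sum of the l_j # b_j, its image is the operator with coefficients c(t), the sum
    of the l_j b_j(t). Independence of the automorphisms gives c = 0, and then [Hfree] gives l_j =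
    0. *)
Lemma smash_map_inj s : smash_map mu s = 0 -> s = 0.
Proof.
move=> s0; apply/matrixP => i j; rewrite mxE.
have /freeP fL := basis_free (vbasisP {:L}); move: i; apply: (fL (s^~ j)).
apply: subvs_inj; move: j; rewrite /=; apply: Hfree.
pose c : grpAlg K aT :=
  [ffun x => \sum_j vsval (\sum_i s i j *: (vbasis {:L})`_i) * vsval b`_j x].
move=> x; have := @act_indep c _ _ x; rewrite ffunE; apply=> [{}x | y Fy].
  by rewrite inE => M'x; rewrite ffunE big1 // => j _; rewrite HM ?mulr0 ?subvsP.
have := congr1 (fun g : 'End(L) => vsval (g (Subvs Fy))) s0.
rewrite smash_mapE zero_lfunE linear0 => e0; rewrite -[RHS]e0 linear_sum /=.
rewrite /diag_act; under [LHS]eq_bigr => t _ do rewrite [c t]ffunE mulr_suml.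
rewrite exchange_big /=.
transitivity (\sum_j \sum_i vsval (s i j *: ((vbasis {:L})`_i * mu b`_j (Subvs Fy)))).
  apply: eq_bigr => j _; under eq_bigr => t _ do rewrite -mulrA.
  rewrite -mulr_sumr linear_sum mulr_suml; apply: eq_bigr => i _.
  by rewrite !linearZ /= act_endE scalerAl.
by rewrite exchange_big; apply: eq_bigr => i _; rewrite linear_sum.
Qed.

(** Injectivity suffices: by [Hdim], source and target both have dimension the square of that of F
    over k. *)
Lemma smash_map_bij : bijective (smash_map mu).
Proof.
pose T : {linear tens L B -> 'End(L)} := smash_map mu.
have T0 : lker (linfun T) == 0%VS.
  by apply/lker0P => s t; rewrite !lfunE => /eqP; rewrite -subr_eq0 -linearB;
     move/eqP/smash_map_inj/eqP; rewrite subr_eq0 => /eqP.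
have imT : limg (linfun T) = fullv.
  apply/eqP; rewrite eqEdim subvf limg_dim_eq ?(eqP T0) ?capv0 // !dimvf.
  rewrite !dim_matrix Hdim /dim /= -!dimvf.
  by rewrite (dimvf L : _ = \dim F) leqnn.
exists (linfun T)^-1%VF => [s | u].
  by have := lker0_lfunK T0 s; rewrite lfunE.
by have := @limg_lfunVK _ _ _ (linfun T) u; rewrite imT memvf lfunE; apply.
Qed.

Lemma diag_hopf_galois : hopf_galois_action S mu.
Proof.
split.
- exact: act_end1.
- exact: act_endM.
- exact: act_end_measure.
- exact: act_end_unit.
- exact: act_end_fixed.
- exact: linearP.
- by apply/lfunP => z; rewrite smash_map_ptens mul1r act_end1.
- exact: smash_map_mul.
- exact: smash_map_bij.
Qed.

End DiagonalAction.

(** * Regular subgroups normalized by the left regular representation *)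

Section RegularSubgroup.
Variables (k : fieldType) (K : splittingFieldType k).
Local Notation G := (gal_of {:K}).
Implicit Types n m : {perm G}.

Definition theta n : G := (n^-1)%g 1%g.

Lemma theta1 : theta 1 = 1%g.
Proof. by rewrite /theta invg1 perm1. Qed.

Lemma permJ_lambda n (a x : G) : (n ^ lambda a)%g (x * a)%g = (n x * a)%g.
Proof. by have := permJ n (lambda a) x; rewrite !permE. Qed.

(** Conjugating n^-1 by lambda(theta m) transports its value at 1 to its value at theta m = m^-1(1),
    which is where the product on the right evaluates it. *)
Lemma theta_mul n m : (theta n * theta m = theta (n ^ lambda (theta m) * m))%g.
Proof.
have := permJ_lambda n^-1%g (theta m) 1%g; rewrite mul1g conjVg => <-.
by rewrite {3}/theta [in RHS]invMg [RHS]permM.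
Qed.

Lemma theta_mulJ n m : theta (n * m) = (theta (n ^ (lambda (theta m))^-1) * theta m)%g.
Proof. by rewrite theta_mul conjgKV. Qed.

Lemma thetaJ n (a : G) : theta (n ^ lambda a) = ((n^-1) (a^-1) * a)%g.
Proof. by rewrite /theta -conjVg -permJ_lambda mulVg. Qed.

(** * The quotient N/P and its action on F *)

Section Quotient.
Variables (N P : {group {perm G}}) (F : {subfield K}).
Hypothesis galK : galois 1 {:K}.
Hypothesis regN : regular_perm N.
Hypothesis nNG : lambdaG K \subset 'N(N)%g.
Hypothesis nsPN : (P <| N)%g.
Hypothesis nPG : lambdaG K \subset 'N(P)%g.
Hypothesis FP : forall x : K, x \in F <-> fixed_by (H_sub P) x.
Local Notation J := ('Gal({:K} / F)%g).
Hypothesis nsJ : (J <| 'Gal({:K} / 1))%g.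

Lemma theta_inj : {in N &, injective theta}.
Proof.
move=> n m Nn Nm tnm; have [_ /(_ 1%g) C1] := regN.
apply: invg_inj; apply/eqP; rewrite eq_mulgV1; apply/eqP/set1gP.
rewrite -C1 inE groupM ?groupV //=; apply/astab1P.
by rewrite /= /aperm permM -/(theta n) tnm /theta permK.
Qed.

Lemma theta_surj (g : G) : exists2 n, n \in N & theta n = g.
Proof.
have [trN _] := regN.
have [n Nn ->] := atransP2 trN (in_setT 1%g) (in_setT g).
by exists n^-1%g; rewrite ?groupV // /theta invgK.
Qed.

Lemma normP_lambda (a : G) : lambda a \in 'N(P)%g.
Proof. by apply: (subsetP nPG); rewrite imset_f ?inE. Qed.

Lemma normN_lambda (a : G) : lambda a \in 'N(N)%g.
Proof. by apply: (subsetP nNG); rewrite imset_f ?inE. Qed.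

(** F is the fixed field of theta(P). If x is fixed by H_P, every h in H_P kills the function p |->
    theta p x - x, and descent with all of K as coefficients separates the points of P. *)
Lemma memF x : x \in F <-> {in P, forall p, theta p x = x}.
Proof.
split=> [/FP Fx p Pp | Fx]; last first.
  apply/FP => h Hh.
  rewrite /grpAlg_eval /aug mulr_suml; apply: eq_bigr => n _.
  have [Pn | P'n] := boolP (n \in P); first by rewrite [X in _ * X]Fx.
  by rewrite (fixed_ring0 Hh P'n) !mul0r.
apply/eqP; rewrite -subr_eq0; apply/eqP; move: p Pp.
apply: (fixed_ring_separates (f := @lambda k K) (E := {:K}%AS)) => //.
- exact: lambdaM.
- exact: normP_lambda.
- by move=> z _ y _; exact: memvf.
move=> h /Fx/eqP; rewrite -subr_eq0 /aug mulr_suml -sumrB => /eqP h0.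
by rewrite -[RHS]h0; apply: eq_bigr => n _; rewrite mulrBr.
Qed.

Lemma theta_group_set : group_set (theta @: P).
Proof.
apply/group_setP; split=> [|_ _ /imsetP[p Pp ->] /imsetP[q Pq ->]].
  by rewrite -theta1 imset_f.
by rewrite theta_mul imset_f // groupM // memJ_norm // normP_lambda.
Qed.

(** Since F is the fixed field of the group theta(P), Artin's theorem identifies its Galois
    group. *)
Lemma galFE : J = theta @: P.
Proof.
have -> : (F : {vspace K}) = fixedField (Group theta_group_set).
  apply/vspaceP => x; apply/idP/fixedFieldP; rewrite ?memvf //.
    by move/memF=> Fx _ /imsetP[p Pp ->]; exact: Fx.
  by move=> Fx; apply/memF => p Pp; apply: Fx; rewrite imset_f.
exact: gal_fixedField.
Qed.

Lemma card_galF : #|J| = #|P|.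
Proof.
rewrite galFE card_in_imset // => p q Pp Pq; apply: theta_inj;
  exact: (subsetP (normal_sub nsPN)).
Qed.

Lemma mem_gal1 (g : G) : g \in 'Gal({:K} / 1)%g.
Proof.
rewrite gal_kHom ?sub1v //; apply/kAHomP => x /vlineP[a ->].
by rewrite linearZ /= rmorph1.
Qed.

Lemma card_N : #|N| = \dim {:K}.
Proof.
have := galois_dim galK; rewrite dimv1 divn1 => ->.
rewrite -(card_in_imset theta_inj); apply: eq_card => g.
by have [n Nn <-] := theta_surj g; rewrite imset_f // mem_gal1.
Qed.

Lemma galF_fix (j : G) x : j \in J -> x \in F -> j x = x.
Proof. by rewrite galFE => /imsetP[p Pp ->] /memF; apply. Qed.

Lemma galF_conj (g j : G) : (g * j * g^-1 \in J)%g = (j \in J).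
Proof.
have Ng : g^-1%g \in 'N(J)%g.
  by rewrite groupV (subsetP (normal_norm nsJ)) ?mem_gal1.
by rewrite -(memJ_norm j Ng) conjgE invgK mulgA.
Qed.

(** Normality of J gives g * theta p = j * g with j in J, and j fixes x. *)
Lemma memF_gal (g : G) x : x \in F -> g x \in F.
Proof.
move=> Fx; apply/memF => p Pp.
have Jp : (g * theta p * g^-1)%g \in J by rewrite galF_conj galFE imset_f.
rewrite -galM ?memvf // -[(g * _)%g](mulgKV g) galM ?memvf //.
by rewrite (galF_fix Jp Fx).
Qed.

Lemma subPN : P \subset N. Proof. exact: normal_sub nsPN. Qed.

Lemma subN_norm : N \subset 'N(P)%g. Proof. exact: normal_norm nsPN. Qed.

(** This is the bijection from N/P to G/J: [theta_mul] turns theta(P) theta(m) into theta(P m), and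
    [theta_inj] brings the converse back to N. *)
Lemma coset_theta n m : n \in N -> m \in N ->
  (coset P n == coset P m) = (theta n * (theta m)^-1 \in J)%g.
Proof.
move=> Nn Nm; have sN := subsetP subN_norm.
apply/eqP/idP => [enm | ].
  have /rcosetP[p Pp ->] : n \in (P :* m)%g.
    by rewrite -val_coset ?sN // -enm val_coset ?sN // rcoset_refl.
  rewrite theta_mulJ mulgK galFE imset_f // memJ_norm //.
  by rewrite groupV normP_lambda.
rewrite galFE => /imsetP[p Pp /(canRL (mulgKV _))].
rewrite theta_mul => tn.
have Pp' : (p ^ lambda (theta m))%g \in P by rewrite memJ_norm ?normP_lambda.
rewrite (theta_inj Nn _ tn) ?coset_kerl // groupM //.
exact: (subsetP subPN).
Qed.

(** The automorphism depends on the chosen representative, but for classes in N/P its restriction to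
    F does not; see [rep_theta_coset]. *)
Definition rep_theta (t : coset_of P) : G := theta (repr t).

Lemma repr_quotient t : t \in (N / P)%g -> repr t \in N.
Proof.
case/morphimP => n nPn Nn ->; have := mem_repr_coset (coset P n).
rewrite val_coset // => /rcosetP[p Pp ->].
by rewrite groupM // (subsetP subPN).
Qed.

Lemma rep_theta_coset n x : n \in N -> x \in F -> rep_theta (coset P n) x = theta n x.
Proof.
move=> Nn Fx; have Nr : repr (coset P n) \in N by rewrite repr_quotient ?mem_quotient.
have Jj : (rep_theta (coset P n) * (theta n)^-1)%g \in J.
  by rewrite -coset_theta // coset_reprK.
rewrite -(mulgKV (theta n) (rep_theta _)) galM ?memvf //.
by rewrite (galF_fix Jj Fx).
Qed.

(* G acts on N/P through G/J. *)
Lemma coset_lambdaJ (j : G) n : j \in J -> n \in N ->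
  coset P (n ^ lambda j) = coset P n.
Proof.
move=> Jj Nn; apply/eqP; rewrite coset_theta ?memJ_norm ?normN_lambda // thetaJ.
(* With j^-1 = theta p, the value n^-1(j^-1) becomes theta(n p), which lies in J theta(n); what
   remains is a conjugate of j. *)
have /imsetP[p Pp jp] : j^-1%g \in theta @: P by rewrite -galFE groupV.
have -> : (n^-1)%g j^-1%g = theta (n * p) by rewrite jp /theta invMg permM.
have Jpn : (theta (n * p) * (theta n)^-1)%g \in J.
  have Np := subsetP subPN p Pp; by rewrite -coset_theta ?groupM // coset_kerr.
rewrite -[theta _](mulgKV (theta n)) -!mulgA [(theta n * _)%g]mulgA mulgA.
by rewrite groupM ?galF_conj.
Qed.

Definition coset_lambda (g : G) : coset_of P := coset P (lambda g).

Lemma coset_lambdaM : {morph coset_lambda : a b / (a * b)%g}.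
Proof.
by move=> a b; rewrite /coset_lambda lambdaM coset_morphM ?normP_lambda.
Qed.

Lemma norm_coset_lambda g : coset_lambda g \in 'N(N / P)%g.
Proof.
apply: (subsetP (quotient_norms P nNG)); rewrite mem_morphim ?normP_lambda //.
by rewrite imset_f ?inE.
Qed.

(** J acts trivially on N/P, so invariance under J says that theta(P) fixes each coefficient. This
    supplies [fixE] for [H_quot]. *)
Lemma fixed_coef_memF (z : grpAlg K (coset_of P)) :
  (forall g, grpAlg_act coset_lambda g z = z) -> {in (N / P)%g, forall t, z t \in F}.
Proof.
move=> fixz _ /morphimP[n nPn Nn ->]; apply/memF => p Pp.
have Jp : theta p \in J by rewrite galFE imset_f.
have nJ : (coset P n ^ coset_lambda (theta p))%g = coset P n.
  by rewrite -[RHS](coset_lambdaJ Jp Nn) morphJ ?normP_lambda.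
have /ffunP/(_ (coset P n)) := fixz (theta p).
by rewrite ffunE -{1}nJ conjgK.
Qed.

Local Notation H := (H_quot F N P).

Lemma H_quot_J h t g : h \in H -> h (t ^ coset_lambda g)%g = g (h t).
Proof. exact: fixed_ringJ. Qed.

Lemma memF_coef h t : h \in H -> h t \in F.
Proof.
case/mem_fixed_ring=> hF h0 _.
by have [/hF | /h0->] := boolP (t \in (N / P)%g); rewrite ?rpred0.
Qed.

Lemma act_memF h x : h \in H -> x \in F -> diag_act rep_theta h x \in F.
Proof.
move=> Hh Fx; apply: rpred_sum => t _.
by rewrite rpredM ?memF_gal ?memF_coef.
Qed.

(** Moving theta(t) past the coefficient h(s) conjugates s by lambda(theta t), and [theta_mul]
    produces the same conjugate from the composite of the two automorphisms. *)
Lemma act_mul g h x : g \in H -> h \in H -> x \in F ->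
  diag_act rep_theta (g * h) x = diag_act rep_theta g (diag_act rep_theta h x).
Proof.
move=> Hg Hh Fx; rewrite /diag_act.
under eq_bigr => z _ do rewrite ffunE mulr_suml.
rewrite exchange_big; apply: eq_bigr => t _ /=.
have [Mt | M't] := boolP (t \in (N / P)%g); last first.
  by rewrite (fixed_ring0 Hg M't) mul0r big1 // => z _; rewrite !mul0r.
rewrite rmorph_sum mulr_sumr.
(* The substitution is z = s' t, with s' the conjugate of s. *)
rewrite (reindex_inj (mulIg t)) (reindex_inj (conjg_inj (coset_lambda (rep_theta t)))) /=.
apply: eq_bigr => s _; rewrite mulgK -mulrA H_quot_J // rmorphM /=.
have [Ms | M's] := boolP (s \in (N / P)%g); last first.
  by rewrite (fixed_ring0 Hh M's) rmorph0 !mul0r.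
congr (_ * (_ * _)); have [Ns Nt] := (repr_quotient Ms, repr_quotient Mt).
have sN := subsetP subN_norm; have Pl := normP_lambda.
have -> : (s ^ coset_lambda (rep_theta t) * t)%g
    = coset P (repr s ^ lambda (rep_theta t) * repr t)%g.
  rewrite (coset_morphM (groupJ (sN _ Ns) (Pl _)) (sN _ Nt)).
  by rewrite (morphJ _ (sN _ Ns) (Pl _)) /= !coset_reprK.
have NJs : (repr s ^ lambda (rep_theta t))%g \in N by rewrite memJ_norm ?normN_lambda.
rewrite (rep_theta_coset (groupM NJs Nt) Fx) /rep_theta -theta_mul.
by rewrite galM ?memvf.
Qed.

Lemma act_one x : x \in F -> rep_theta 1 x = x.
Proof.
by move=> Fx; rewrite -(coset_id (group1 P)) rep_theta_coset // theta1 gal_id.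
Qed.

Lemma act_fix x : x \in F -> {in (N / P)%g, forall t, rep_theta t x = x} ->
  x \in 1%VS.
Proof.
move=> Fx fix_x; apply: (mem_base galK) => g; have [n Nn <-] := theta_surj g.
by rewrite -rep_theta_coset // fix_x ?mem_quotient.
Qed.

(* Dedekind's independence on K, applied to traces from K to F. *)
Lemma act_indep (c : grpAlg K (coset_of P)) :
  {in [predC (N / P)%g], forall t, c t = 0} ->
  (forall y, y \in F -> diag_act rep_theta c y = 0) -> forall t, c t = 0.
Proof.
move=> c0 cF t; have [Mt | M't] := boolP (t \in (N / P)%g); last exact: c0.
(* C spreads c over G, constant on the cosets J g, so that the sum of the C(g) g(w) is c applied to
   the trace of w from K to F. *)
pose C (g : G) := \sum_(s in (N / P)%g | (g * (rep_theta s)^-1)%g \in J) c s.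
have <- : C (rep_theta t) = c t.
  rewrite /C (big_pred1 t) // => s /=; apply/andP/eqP => [[Ms] | ->]; last first.
    by rewrite mulgV group1.
  rewrite -coset_theta ?repr_quotient // !coset_reprK => /eqP; exact: esym.
apply: (@gal_independent _ _ _ predT C) => // w _.
have Fw : galTrace F {:K} w \in F.
  by apply: mem_galTrace; rewrite ?memvf //; apply: galoisS galK; rewrite sub1v subvf.
rewrite -[RHS](cF _ Fw) /diag_act [RHS](bigID (mem (N / P)%g)) /=.
rewrite [X in _ = _ + X]big1 ?addr0 => [|s /c0->]; last by rewrite mul0r.
under eq_bigr => g _ do rewrite mulr_suml.
rewrite (exchange_big_dep (mem (N / P)%g)) //=; last by move=> g s _ /andP[].
apply: eq_bigr => s Ms; rewrite -mulr_sumr; congr (_ * _).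
rewrite rmorph_sum (reindex_inj (mulIg (rep_theta s))) /=.
under eq_bigl => g do rewrite mulgK Ms.
by apply: eq_bigr => g _; rewrite galM ?memvf.
Qed.

(** Descent gives the order of N/P, which is |N| / |P| = [K : k] / |J| = [K : k] / [K : F]. *)
Lemma dim_H_quot : \dim {:subvs_of H} = \dim F.
Proof.
rewrite (dim_fixed_ring galK coset_lambdaM norm_coset_lambda fixed_coef_memF).
have galF : galois F {:K} by apply: galoisS galK; rewrite sub1v subvf.
rewrite card_quotient ?subN_norm // -divgS ?subPN // card_N -card_galF.
rewrite -(galois_dim galF) -{1}(divnK (field_dimS (subvf F))) mulKn //.
by rewrite divn_gt0 ?adim_gt0 // dimvS ?subvf.
Qed.

End Quotient.
End RegularSubgroup.

(** A separable polynomial over k that kills x in K also kills x in F, and separability is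
    insensitive to the field of coefficients. *)
Lemma separable_subvs (k : fieldType) (K : fieldExtType k) (F : {subfield K}) :
  separable 1 {:K} -> separable 1 {:subvs_of F}.
Proof.
move=> /separableP sepK; apply/separableP => x _.
have /separable_elementP[p [/polyOver1P[q ->] px sepq]] := sepK (vsval x) (memvf _).
apply/separable_elementP; exists (map_poly (in_alg (subvs_of F)) q); split.
- by apply/polyOver1P; exists q.
- rewrite -(fmorph_root (vsval : {rmorphism subvs_of F -> K})) -map_poly_comp.
  rewrite (eq_map_poly (g := in_alg K)) // => a /=.
  by rewrite algid1.
by move: sepq; rewrite !separable_map.
Qed.

Theorem theorem2p9 (k : fieldType) (K : splittingFieldType k)
    (hK : galois 1 {:K}) (N P : {group {perm gal_of {:K}}})
    (hN : regular_perm N) (hNG : lambdaG K \subset 'N(N)%g)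
    (hP : (P <| N)%g) (hPG : lambdaG K \subset 'N(P)%g)
    (F : {subfield K}) (hF : forall x : K, x \in F <-> fixed_by (H_sub P) x)
    (hJ : ('Gal({:K} / F) <| 'Gal({:K} / 1))%g) :
  exists S : hopf_structure (subvs_of (H_quot F N P)),
    inherited_hopf S /\ hopf_galois (subvs_of F) S.
Proof.
have fM := coset_lambdaM hPG; have nMf := norm_coset_lambda hNG hPG.
have fixE := fixed_coef_memF hN hNG hP hPG hF hJ.
have [S SH] := fixed_ring_hopf_exists hK fM nMf fixE.
exists S; split=> //; split.
  by apply: separable_subvs; case/and3P: hK.
eexists; apply: (diag_hopf_galois (M := (N / P)%g) (e := @rep_theta _ _ P) SH).
- exact: fixed_ring1.
- by move=> h x; apply: fixed_ring0.
- exact: fixed_ring_free.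
- exact: (dim_H_quot hK hN hNG hP hPG hF hJ).
- exact: (fixed_ring_separates fM nMf fixE).
- exact: (act_one hN hP hPG hF).
- exact: (act_memF hPG hF hJ).
- exact: (act_mul hN hNG hP hPG hF).
- exact: (act_indep hK hN hP hPG hF).
- exact: (act_fix hK hN hP hPG hF).
Qed.
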